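(* There exists a semi-positive $Q$-tensor $\mathscr{A}\in\mathbb{T}_{3,2}$ for which TCP$(0,\mathscr{A})$ has a nonzero solution with only one nonzero component. (Hence it is not true that every nonzero solution of TCP$(0,\mathscr{A})$ has at least two nonzero components whenever $\mathscr{A}$ is a semi-positive $Q$-tensor.)
   Context: $[n]=\{1,\ldots,n\}$, $\mathbb{R}^n_+=\{x\in\mathbb{R}^n:x\ge 0\}$ (componentwise). $\mathbb{T}_{m,n}$ is the set of real $m$-order $n$-dimensional tensors $\mathscr{A}=(a_{i_1\cdots i_m})$, $a_{i_1\cdots i_m}\in\mathbb{R}$ for $i_1,\ldots,i_m\in[n]$ (no symmetry assumed). For $x\in\mathbb{R}^n$, $\mathscr{A}x^{m-1}\in\mathbb{R}^n$ is defined by $(\mathscr{A}x^{m-1})_i=\sum_{i_2,\ldots,i_m=1}^n a_{ii_2\cdots i_m}x_{i_2}\cdots x_{i_m}$. For $q\in\mathbb{R}^n$, TCP$(q,\mathscr{A})$ is the problem of finding $x\in\mathbb{R}^n$ with $x\ge 0$, $\mathscr{A}x^{m-1}+q\ge 0$, $x^T(\mathscr{A}x^{m-1}+q)=0$. $\mathscr{A}$ is a $Q$-tensor if TCP$(q,\mathscr{A})$ has a solution for every $q\in\mathbb{R}^n$. $\mathscr{A}$ is semi-positive if for each $x\in\mathbb{R}^n_+\setminus\{0\}$ there is $i\in[n]$ with $x_i>0$ and $(\mathscr{A}x^{m-1})_i\ge 0$. *)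

(* Defs.v *)
From HB Require Import structures.
From mathcomp Require Import all_boot all_order all_algebra.
From mathcomp Require Import reals.

Set Implicit Arguments.
Unset Strict Implicit.
Unset Printing Implicit Defensive.

Import Order.TTheory GRing.Theory Num.Theory.
Local Open Scope ring_scope.

Definition tensor (R : realType) (m n : nat) : Type := m.-tuple 'I_n -> R.

(* The order is written m.+1, so that [tensor_apply A x] is the vector usually
   denoted A x^((m+1)-1) = A x^m; [t] ranges over the m trailing indices. *)
Definition tensor_apply (R : realType) (m n : nat)
    (A : tensor R m.+1 n) (x : 'cV[R]_n) : 'cV[R]_n :=
  \col_i \sum_(t : m.-tuple 'I_n)
    A [tuple of i :: t] * \prod_(k < m) x (tnth t k) 0.

Definition nonneg_vec (R : realType) (n : nat) (x : 'cV[R]_n) : Prop :=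
  forall i : 'I_n, 0 <= x i 0.

Definition TCP_solution (R : realType) (m n : nat)
    (q : 'cV[R]_n) (A : tensor R m.+1 n) (x : 'cV[R]_n) : Prop :=
  [/\ nonneg_vec x,
      nonneg_vec (tensor_apply A x + q)
    & x^T *m (tensor_apply A x + q) = 0].

Definition Q_tensor (R : realType) (m n : nat) (A : tensor R m.+1 n) : Prop :=
  forall q : 'cV[R]_n, exists x : 'cV[R]_n, TCP_solution q A x.

Definition semi_positive (R : realType) (m n : nat)
    (A : tensor R m.+1 n) : Prop :=
  forall x : 'cV[R]_n, nonneg_vec x -> x <> 0 ->
    exists i : 'I_n, 0 < x i 0 /\ 0 <= tensor_apply A x i 0.

Definition num_nonzero (R : realType) (n : nat) (x : 'cV[R]_n) : nat :=
  #|[set i : 'I_n | x i 0 != 0]|.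

(* Main.v *)
Require Import Defs.
From HB Require Import structures.
From mathcomp Require Import all_boot all_order all_algebra.
From mathcomp Require Import reals.
From mathcomp Require Import ring.

(** The witness is the tensor with A (x, y)^2 = (y^2, y (y - x)). It is
    semi-positive because its first component is a square, and it vanishes at
    (1, 0). For q not nonnegative, TCP(q, A) is solved on the y-axis by
    y = sqrt (- q2) when q2 <= q1, and otherwise by making both components
    vanish: y = sqrt (- q1) and x = y + q2 / y. *)

Set Implicit Arguments.
Unset Strict Implicit.
Unset Printing Implicit Defensive.

Import Order.TTheory GRing.Theory Num.Theory.
Local Open Scope ring_scope.

Lemma big_tuple2 (T : finType) (R : nmodType) (F : 2.-tuple T -> R) :
  \sum_t F t = \sum_i \sum_j F [tuple i; j].
Proof.
rewrite pair_bigA (reindex (fun p : T * T => [tuple p.1; p.2])) //=.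
exists (fun t => (tnth t 0, tnth t 1)) => [[i j] _ | t _] //.
case/tupleP: t => i t; case/tupleP: t => j t; rewrite (tuple0 t).
exact: val_inj.
Qed.

Lemma forall_ord2 (P : 'I_2 -> Prop) : P 0 -> P 1 -> forall i, P i.
Proof.
move=> P0 P1; case=> [[|[|//]]] lt_i2.
  by rewrite (_ : Ordinal _ = 0) //; apply: val_inj.
by rewrite (_ : Ordinal _ = 1) //; apply: val_inj.
Qed.

Lemma sum_ord2 (R : nmodType) (F : 'I_2 -> R) : \sum_i F i = F 0 + F 1.
Proof.
rewrite big_ord_recl big_ord1; congr (_ + F _); exact: val_inj.
Qed.

Lemma prod_ord2 (R : pzRingType) (F : 'I_2 -> R) : \prod_i F i = F 0 * F 1.
Proof.
rewrite big_ord_recl big_ord1; congr (_ * F _); exact: val_inj.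
Qed.

Lemma tensor_apply3_2 (R : realType) (A : tensor R 3 2) (x : 'cV[R]_2) i :
  tensor_apply A x i 0 =
    A [tuple i; 0; 0] * x 0 0 ^+ 2
    + (A [tuple i; 0; 1] + A [tuple i; 1; 0]) * (x 0 0 * x 1 0)
    + A [tuple i; 1; 1] * x 1 0 ^+ 2.
Proof.
have E (j k : 'I_2) : A [tuple of i :: [tuple j; k]] = A [tuple i; j; k].
  by congr A; apply: val_inj.
rewrite mxE big_tuple2 !sum_ord2 !prod_ord2 !E !(tnth_nth 0) /=; ring.
Qed.

(** Entries (1,0,1) and (1,1,0) both multiply the monomial x y, so only their sum matters; the
    coefficient -1 is put entirely on the first. *)
Definition witness_tensor (R : realType) : tensor R 3 2 := fun t =>
  if t == [tuple 0; 1; 1] then 1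
  else if t == [tuple 1; 1; 1] then 1
  else if t == [tuple 1; 0; 1] then -1
  else 0.

Definition col2 (R : realType) (a b : R) : 'cV[R]_2 :=
  \col_i (if i == 0 then a else b).

Lemma col2_0 (R : realType) (a b : R) : col2 a b 0 0 = a.
Proof. by rewrite mxE. Qed.

Lemma col2_1 (R : realType) (a b : R) : col2 a b 1 0 = b.
Proof. by rewrite mxE. Qed.

Lemma witness_apply0 (R : realType) (x : 'cV[R]_2) :
  tensor_apply (witness_tensor R) x 0 0 = x 1 0 ^+ 2.
Proof. by rewrite tensor_apply3_2 /witness_tensor /=; ring. Qed.

Lemma witness_apply1 (R : realType) (x : 'cV[R]_2) :
  tensor_apply (witness_tensor R) x 1 0 = x 1 0 * (x 1 0 - x 0 0).
Proof. by rewrite tensor_apply3_2 /witness_tensor /=; ring. Qed.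

Lemma witness_semi_positive (R : realType) : semi_positive (witness_tensor R).
Proof.
move=> x x_ge0 x_neq0; have [x0_eq0|x0_neq0] := eqVneq (x 0 0) 0; last first.
  by exists 0; rewrite witness_apply0 sqr_ge0 lt_def x0_neq0 x_ge0.
(* On the y-axis the second component y (y - x) is y^2 too, and a nonzero vector there has y > 0. *)
exists 1; rewrite witness_apply1 x0_eq0 subr0 -expr2 sqr_ge0; split=> //.
rewrite lt_def x_ge0 andbT; apply/eqP => x1_eq0; apply: x_neq0.
by apply/matrixP => i j; rewrite ord1 mxE; move: i; apply: forall_ord2.
Qed.

(** Reduces the problem to scalar conditions. Complementarity is asked for in each component; the
    two products then sum to the inner product. *)
Lemma witness_TCP_solution (R : realType) (q : 'cV[R]_2) (a b : R) :
  0 <= a -> 0 <= b -> 0 <= b ^+ 2 + q 0 0 -> 0 <= b * (b - a) + q 1 0 ->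
  a * (b ^+ 2 + q 0 0) = 0 -> b * (b * (b - a) + q 1 0) = 0 ->
  TCP_solution q (witness_tensor R) (col2 a b).
Proof.
move=> a_ge0 b_ge0 F0 F1 C0 C1.
have E0 : (tensor_apply (witness_tensor R) (col2 a b) + q) 0 0 = b ^+ 2 + q 0 0.
  by rewrite mxE witness_apply0 col2_1.
have E1 : (tensor_apply (witness_tensor R) (col2 a b) + q) 1 0
          = b * (b - a) + q 1 0.
  by rewrite mxE witness_apply1 col2_0 col2_1.
split.
- by apply: forall_ord2; rewrite ?col2_0 ?col2_1.
- by apply: forall_ord2; rewrite ?E0 ?E1.
- apply/matrixP => i j; rewrite !ord1 [RHS]mxE mxE sum_ord2 E0 E1.
  by rewrite !(mxE trmx_key) col2_0 col2_1 C0 C1 addr0.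
Qed.

Lemma witness_Q_tensor (R : realType) : Q_tensor (witness_tensor R).
Proof.
move=> q.
have [/andP[q0_ge0 q1_ge0]|q_nge0] := boolP ((0 <= q 0 0) && (0 <= q 1 0)).
  (* For q nonnegative the zero vector is a solution. *)
  by exists (col2 0 0); apply: witness_TCP_solution;
    rewrite ?subrr ?expr0n ?mul0r ?add0r.
have [le_q10|lt_q01] := leP (q 1 0) (q 0 0).
  have q1_lt0 : q 1 0 < 0.
    by case: ltP q_nge0 => // q1_ge0; rewrite (le_trans q1_ge0 le_q10).
  have /sqr_sqrtr s2 : 0 <= - q 1 0 by rewrite oppr_ge0 ltW.
  (* With x = 0 and y^2 = - q2 the second component vanishes, and the first is q1 - q2, nonnegative
     in this case. *)
  exists (col2 0 (Num.sqrt (- q 1 0))); apply: witness_TCP_solution;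
    by rewrite ?sqrtr_ge0 ?mul0r ?subr0 -?expr2 ?s2 ?addNr ?mulr0 // addrC
       subr_ge0.
have q0_lt0 : q 0 0 < 0.
  by case: ltP q_nge0 => // q0_ge0; rewrite (le_trans q0_ge0 (ltW lt_q01)).
have s_gt0 : 0 < Num.sqrt (- q 0 0) by rewrite sqrtr_gt0 oppr_gt0.
have /sqr_sqrtr : 0 <= - q 0 0 by rewrite oppr_ge0 ltW.
(* From here on only s > 0 and s^2 = - q1 matter. *)
move: (Num.sqrt _) s_gt0 => s s_gt0 s2.
have s_neq0 : s != 0 by rewrite gt_eqF.
have F0 : s ^+ 2 + q 0 0 = 0 by rewrite s2 addNr.
have F1 : s * (s - (s + q 1 0 / s)) + q 1 0 = 0 by field.
exists (col2 (s + q 1 0 / s) s); apply: witness_TCP_solution;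
  rewrite ?F0 ?F1 ?mulr0 ?lexx ?(ltW s_gt0) //.
(* Here q1 < q2 enters: the numerator equals q2 - q1, so the first coordinate is nonnegative. *)
have -> : s + q 1 0 / s = (s ^+ 2 + q 1 0) / s by field.
by rewrite divr_ge0 ?(ltW s_gt0) // s2 addrC subr_ge0 ltW.
Qed.

(** Both components of A (x, y)^2 have the factor y, so the whole x-axis is sent to 0. *)
Lemma witness_TCP0_solution (R : realType) :
  TCP_solution 0 (witness_tensor R) (col2 1 0).
Proof.
by apply: witness_TCP_solution;
  rewrite ?mxE ?expr0n /= ?mul0r ?addr0 ?mulr0 ?ler01.
Qed.

Lemma num_nonzero_col2_10 (R : realType) : num_nonzero (col2 (1 : R) 0) = 1%N.
Proof.
rewrite /num_nonzero (_ : [set i | _] = [set 0]) ?cards1 //.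
apply/setP; apply: forall_ord2; by rewrite !inE mxE /= ?oner_neq0 ?eqxx.
Qed.

Theorem mainTheorem4 (R : realType) :
  (exists A : tensor R 3 2,
     [/\ semi_positive A, Q_tensor A
       & exists x : 'cV[R]_2,
           [/\ TCP_solution 0 A x, x <> 0 & num_nonzero x = 1%N]])
  /\
  ~ (forall (m n : nat) (A : tensor R m.+1 n),
       semi_positive A -> Q_tensor A ->
       forall x : 'cV[R]_n, TCP_solution 0 A x -> x <> 0 ->
         (2 <= num_nonzero x)%N).
Proof.
have e1_neq0 : col2 (1 : R) 0 <> 0.
  by move/matrixP/(_ 0 0)/eqP; rewrite !mxE /= oner_eq0.
split=> [|all_ge2].
  exists (witness_tensor R); split.
  - exact: witness_semi_positive.
  - exact: witness_Q_tensor.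
  - exists (col2 1 0); split=> //; first exact: witness_TCP0_solution.
    exact: num_nonzero_col2_10.
(* The same witness and the vector (1, 0) turn the universal claim into 2 <= 1. *)
have := all_ge2 _ _ _ (@witness_semi_positive R) (@witness_Q_tensor R) _
  (@witness_TCP0_solution R) e1_neq0.
by rewrite num_nonzero_col2_10.
Qed.
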